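(* Let $\alpha\in(0,1)$, let $X$ and $Y$ be normed spaces over $\mathbb{C}$, let $B_X(0,1)$ be the open unit ball of $X$, and let $f:B_X(0,1)\to Y$ be an analytic mapping. Then there is a constant $C_f$ such that $$\|Df(z)\|\le C_f(1-\|z\|_X)^{\alpha-1},\quad z\in B_X(0,1),$$ if and only if there is a constant $C'_f$ such that $f$ satisfies the Hölder condition $$\|f(z)-f(w)\|_Y\le C'_f\|z-w\|_X^\alpha,\quad z,w\in B_X(0,1).$$ Moreover, the constants satisfy the estimates $C'_f\le\frac{4}{\alpha}C_f$ and $C_f\le\frac{2}{\alpha}C'_f$; that is, if the first inequality holds with $C_f$, then the second holds with some $C'_f\le\frac4\alpha C_f$, and if the second holds with $C'_f$, then the first holds with some $C_f\le\frac2\alpha C'_f$.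
   Context: A mapping $f:D\to Y$ from a domain $D$ of a complex normed space $X$ to a complex normed space $Y$ is analytic if it is Fréchet differentiable (over $\mathbb{C}$) at every point of $D$, with Fréchet differential $Df(x):X\to Y$ a continuous $\mathbb{C}$-linear map. $\|Df(x)\|=\sup_{\|\zeta\|_X=1}\|Df(x)\zeta\|_Y$ is its operator norm. *)

(* Defs.v *)
From Stdlib Require Import Reals ClassicalEpsilon.
From Coquelicot Require Import Coquelicot.

Local Open Scope R_scope.

(* Complex normed spaces are Coquelicot's [NormedModule C_AbsRing]; they are not
   assumed complete. *)

Definition unit_ball {X : NormedModule C_AbsRing} (z : X) : Prop := norm z < 1.

(* A mapping on the unit ball is given by a total function [f : X -> Y] whose
   values outside the ball are irrelevant: the ball is open and [locally z] only
   sees the germ of [f] at [z]. [filterdiff] over [C_AbsRing] requires the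
   differential to be C-linear and bounded. *)
Definition analytic_on_ball {X Y : NormedModule C_AbsRing} (f : X -> Y) : Prop :=
  forall z : X, unit_ball z -> exists l : X -> Y, filterdiff f (locally z) l.

(* The Fréchet differential at [z]; unspecified where [f] is not
   differentiable. *)
Definition frechet {X Y : NormedModule C_AbsRing} (f : X -> Y) (z : X) : X -> Y :=
  epsilon (inhabits (fun _ : X => zero : Y))
          (fun l : X -> Y => filterdiff f (locally z) l).

(* For a bounded linear map the supremum is finite if [X] is nonzero; if [X] is
   the zero space, it is the supremum of the empty set, [m_infty], which [real]
   sends to 0. *)
Definition opnorm {X Y : NormedModule C_AbsRing} (l : X -> Y) : R :=
  real (Lub_Rbar (fun r => exists zeta : X, norm zeta = 1 /\ r = norm (l zeta))).

(* [Rpower 0 a] is 1 in the standard library, whereas the Hölder condition needs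
   0 ^ a = 0 for [a > 0]. *)
Definition rpow (x a : R) : R := if Rlt_dec 0 x then Rpower x a else 0.

Definition differential_bound {X Y : NormedModule C_AbsRing}
    (alpha : R) (f : X -> Y) (C : R) : Prop :=
  forall z : X, unit_ball z ->
    opnorm (frechet f z) <= C * rpow (1 - norm z) (alpha - 1).

Definition holder_bound {X Y : NormedModule C_AbsRing}
    (alpha : R) (f : X -> Y) (C : R) : Prop :=
  forall z w : X, unit_ball z -> unit_ball w ->
    norm (minus (f z) (f w)) <= C * rpow (norm (minus z w)) alpha.

(* Main.v *)
Require Import Defs.
From Stdlib Require Import Reals Lra Lia ClassicalEpsilon ssreflect.
From Coquelicot Require Import Coquelicot.
Local Open Scope R_scope.

(** This is the theorem of Hardy and Littlewood for maps between complex normed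
    spaces. As [Y] need not be complete, there are no integrals with values in it.

    From the bound on the differential to the Hölder condition: join [z] to [w] by
    going radially inwards from each of them until the depth (the distance to the unit
    sphere) is at least [min (norm (z - w)) 1], and then across. Integrating the bound along the two radial pieces gives
    [C / alpha * norm (z - w) ^ alpha] for each, and the piece across gives at most
    [C * norm (z - w) ^ alpha], for a total below [4 / alpha * C]. The integration is
    replaced by the mean value inequality [norm_increment_le], which compares the
    curve with a primitive of the bound ([radial_increment],
    [holder_of_differential_bound]).

    From the Hölder condition to the differential: for a unit vector [zeta], apply
    Cauchy's estimate to the function [x |-> f (z + x zeta)] of one complex variable
    on the disc of radius [(1 - norm z) / 2] ([differential_bound_of_holder]).

    The substance is therefore Cauchy's estimate ([cauchy_estimate]) for a
    differentiable function of one complex variable with values in an incomplete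
    space and with no continuity of the derivative assumed. Goursat's bisection
    argument works without integrals if contour integrals are replaced by dyadic
    Riemann sums: these split exactly when a rectangle is bisected and vanish exactly
    on affine functions, so they tend to zero on rectangles where the function is
    differentiable ([boundary_sum_tends_to_zero]). In logarithmic coordinates an
    annulus around [0] becomes a rectangle of height [2 pi] with matching horizontal
    edges, and the means of [(g x - g 0) / x] over all circles around [0] agree in
    the limit; small circles give the derivative of [g] at [0]. *)

(** * Algebra and first order expansions *)

Lemma plus_minus_interchange {G : AbelianGroup} (x y u v : G) :
  minus (plus x y) (plus u v) = plus (minus x u) (minus y v).
Proof.
  unfold minus. rewrite opp_plus -!plus_assoc. f_equal.
  rewrite !plus_assoc. f_equal. apply plus_comm.
Qed.

Lemma minus_minus_interchange {G : AbelianGroup} (x y u v : G) :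
  minus (minus x y) (minus u v) = minus (minus x u) (minus y v).
Proof.
  unfold minus at 2 3. rewrite plus_minus_interchange. unfold minus at 3 5.
  now rewrite opp_plus.
Qed.

Lemma norm_minus_sym {K : AbsRing} {V : NormedModule K} (x y : V) :
  norm (minus x y) = norm (minus y x).
Proof. now rewrite -norm_opp opp_minus. Qed.

Lemma norm_minus_trans {K : AbsRing} {V : NormedModule K} (x y z : V) :
  norm (minus x z) <= norm (minus x y) + norm (minus y z).
Proof. rewrite (minus_trans y). apply norm_triangle. Qed.

Lemma norm_scal_C {Y : NormedModule C_AbsRing} (k : C) (y : Y) :
  norm (scal k y) = Cmod k * norm y.
Proof.
  apply Rle_antisym; [apply (norm_scal (V := Y) k)|].
  destruct (Ceq_dec k 0) as [->|hk].
  - rewrite Cmod_0 Rmult_0_l. apply norm_ge_0.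
  - assert (h : norm y <= / Cmod k * norm (scal k y)).
    { rewrite -Cmod_inv; [|exact hk].
      eapply Rle_trans; [|apply (norm_scal (V := Y) (/ k)%C)].
      rewrite scal_assoc. change (mult (/ k)%C k) with (/ k * k)%C.
      rewrite Cinv_l; [|exact hk]. change (RtoC 1) with (one : C_AbsRing).
      rewrite scal_one. apply Rle_refl. }
    apply Rmult_le_reg_l with (/ Cmod k).
    + apply Rinv_0_lt_compat, Cmod_gt_0, hk.
    + rewrite -Rmult_assoc Rinv_l; [|now apply Rgt_not_eq, Cmod_gt_0].
      now rewrite Rmult_1_l.
Qed.

Lemma Cmod_Ci : Cmod Ci = 1.
Proof. unfold Cmod, Ci; simpl. replace (0 * (0 * 1) + 1 * (1 * 1)) with 1 by ring. apply sqrt_1. Qed.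

Lemma Cmod_le_Rabs_plus (x y : R) : Cmod (x, y) <= Rabs x + Rabs y.
Proof.
  replace (x, y) with (RtoC x + Ci * RtoC y)%C
    by (apply injective_projections; simpl; ring).
  eapply Rle_trans; [apply Cmod_triangle|].
  rewrite Cmod_mult Cmod_Ci !Cmod_R. lra.
Qed.

Lemma derivable_pt_lim_expansion (f : R -> R) (x l : R) :
  derivable_pt_lim f x l ->
  forall eps, 0 < eps -> exists d, 0 < d /\ forall h, Rabs h < d ->
    Rabs (f (x + h) - f x - l * h) <= eps * Rabs h.
Proof.
  intros hf eps heps. destruct (hf eps heps) as [d hd].
  exists d. split; [apply cond_pos|]. intros h hh.
  destruct (Req_dec h 0) as [->|h0].
  - rewrite Rplus_0_r. replace (f x - f x - l * 0) with 0 by ring. rewrite Rabs_R0. lra.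
  - specialize (hd h h0 hh).
    replace (f (x + h) - f x - l * h) with (((f (x + h) - f x) / h - l) * h) by (field; lra).
    rewrite Rabs_mult. apply Rmult_le_compat_r; [apply Rabs_pos | lra].
Qed.

Lemma is_derive_C_intro {Y : NormedModule C_AbsRing} (f : C -> Y) (z : C) (l : Y) :
  (forall eps, 0 < eps -> exists d, 0 < d /\ forall w, Cmod (w - z) < d ->
     norm (minus (minus (f w) (f z)) (scal (w - z)%C l)) <= eps * Cmod (w - z)) ->
  is_derive (K := C_AbsRing) f z l.
Proof.
  intros h. split; [apply is_linear_scal_l|].
  intros x hx.
  apply (is_filter_lim_locally_unique (V := AbsRing_NormedModule C_AbsRing)) in hx. subst x.
  intros eps. destruct (h eps (cond_pos eps)) as [d [hd H]].
  exists (mkposreal d hd). exact H.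
Qed.

(** The increment is compared between two arbitrary points near [z0], so that
    differences of values at opposite edges of a small rectangle can be
    estimated; with [z = z0] it is the usual first order expansion. *)
Lemma is_derive_two_points {Y : NormedModule C_AbsRing} (phi : C -> Y) (z0 : C) (l : Y) :
  is_derive (K := C_AbsRing) phi z0 l ->
  forall eps, 0 < eps -> exists d, 0 < d /\ forall z w : C,
    Cmod (z - z0) < d -> Cmod (w - z0) < d ->
    norm (minus (minus (phi w) (phi z)) (scal (w - z)%C l))
      <= eps * (Cmod (z - z0) + Cmod (w - z0)).
Proof.
  intros [_ h] eps heps.
  destruct (h z0 (fun P hP => hP) (mkposreal eps heps)) as [d hd].
  exists d. split; [apply cond_pos|]. intros z w hz hw.
  pose proof (hd z hz) as h1. pose proof (hd w hw) as h2. simpl in h1, h2.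
  match type of h1 with norm ?A <= _ => set (rz := A) in h1 end.
  match type of h2 with norm ?A <= _ => set (rw := A) in h2 end.
  replace (minus (minus (phi w) (phi z)) (scal (w - z)%C l)) with (minus rw rz).
  - eapply Rle_trans; [apply norm_triangle|]. rewrite norm_opp.
    change (norm (minus z z0)) with (Cmod (z - z0)) in h1.
    change (norm (minus w z0)) with (Cmod (w - z0)) in h2. lra.
  - unfold rw, rz.
    replace (w - z)%C with (minus (minus w z0) (minus z z0) : C_AbsRing).
    2:{ change ((w - z0) - (z - z0) = w - z)%C. ring. }
    now rewrite minus_minus_interchange -scal_minus_distr_r
      (minus_minus_interchange (phi w)) minus_eq_zero minus_zero_r.
Qed.

(** * Bisection of rectangles *)

Lemma nested_dyadic_intervals (x : nat -> R) (a : R) (ha : 0 < a) :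
  (forall k, x k <= x (S k) /\ x (S k) + a / 2 ^ S k <= x k + a / 2 ^ k) ->
  exists l, forall k, x k <= l <= x k + a / 2 ^ k.
Proof.
  intros hx.
  assert (hpos : forall k, 0 < a / 2 ^ k).
  { intros k. apply Rdiv_lt_0_compat; [lra | apply pow_lt; lra]. }
  assert (hmono : forall j k, x k <= x (j + k)%nat /\
      x (j + k)%nat + a / 2 ^ (j + k) <= x k + a / 2 ^ k).
  { intros j k. induction j as [|j IH]; simpl plus; [split; apply Rle_refl|].
    destruct (hx (j + k)%nat) as [h1 h2]. destruct IH as [h3 h4].
    split; [now apply Rle_trans with (x (j + k)%nat)|].
    now apply Rle_trans with (x (j + k)%nat + a / 2 ^ (j + k)). }
  assert (hcross : forall j k, x j <= x k + a / 2 ^ k).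
  { intros j k. destruct (Nat.le_ge_cases j k) as [h|h].
    - replace k with ((k - j) + j)%nat by lia.
      pose proof (hmono (k - j)%nat j). pose proof (hpos ((k - j) + j)%nat). lra.
    - replace j with ((j - k) + k)%nat by lia.
      pose proof (hmono (j - k)%nat k). pose proof (hpos ((j - k) + k)%nat). lra. }
  destruct (completeness (fun r => exists k, r = x k)) as [l [hub hlub]].
  - exists (x 0%nat + a / 2 ^ 0). intros r [k ->]. apply hcross.
  - exists (x 0%nat). now exists 0%nat.
  - exists l. intros k. split.
    + apply hub. now exists k.
    + apply hlub. intros r [j ->]. apply hcross.
Qed.

(** Induction by bisection, the compactness step of Goursat's argument: if [P]
    failed on the large rectangle, it would fail on one of the four quarters, and
    so on, and the quarters shrink to a point where [P] holds locally. The local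
    hypothesis only concerns rectangles containing the point, because the bound of
    [boundary_sum_small_near] is relative to the size of the rectangle. *)
Lemma rectangle_bisection (P : R -> R -> R -> R -> Prop) (s0 t0 a0 b0 : R) :
  0 < a0 -> 0 < b0 ->
  (forall s t a b,
     P s t (a / 2) (b / 2) -> P (s + a / 2) t (a / 2) (b / 2) ->
     P s (t + b / 2) (a / 2) (b / 2) ->
     P (s + a / 2) (t + b / 2) (a / 2) (b / 2) -> P s t a b) ->
  (forall u v, s0 <= u <= s0 + a0 -> t0 <= v <= t0 + b0 ->
     exists d, 0 < d /\ forall s t a b, 0 < a < d -> 0 < b < d ->
       s <= u <= s + a -> t <= v <= t + b -> P s t a b) ->
  P s0 t0 a0 b0.
Proof.
  intros ha hb hsplit hloc.
  destruct (excluded_middle_informative (P s0 t0 a0 b0)) as [h|hbad]; [exact h|].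
  exfalso.
  set (side := fun (c : R) (k : nat) => c / 2 ^ k).
  set (Q := fun k (p : R * R) => P (fst p) (snd p) (side a0 k) (side b0 k)).
  assert (hside : forall c k, side c (S k) = side c k / 2).
  { intros c k. unfold side. simpl. field. apply pow_nonzero; lra. }
  assert (hpos : forall c k, 0 < c -> 0 < side c k).
  { intros c k hc. apply Rdiv_lt_0_compat; [lra | apply pow_lt; lra]. }
  assert (hstep : forall k p, exists q, ~ Q k p ->
      ~ Q (S k) q /\
      (fst p <= fst q /\ fst q + side a0 (S k) <= fst p + side a0 k) /\
      (snd p <= snd q /\ snd q + side b0 (S k) <= snd p + side b0 k)).
  { intros k [s t].
    pose proof (hpos a0 k ha). pose proof (hpos b0 k hb).
    destruct (excluded_middle_informative (exists q, ~ Q (S k) q /\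
      (s <= fst q /\ fst q + side a0 (S k) <= s + side a0 k) /\
      (t <= snd q /\ snd q + side b0 (S k) <= t + side b0 k))) as [[q hq]|hno].
    - now exists q.
    (* No quarter of the present rectangle is bad, hence neither is the rectangle. *)
    - exists (s, t). intros hQ. exfalso. apply hQ. unfold Q; simpl.
      assert (hchild : forall s' t',
        s <= s' /\ s' + side a0 (S k) <= s + side a0 k ->
        t <= t' /\ t' + side b0 (S k) <= t + side b0 k ->
        P s' t' (side a0 (S k)) (side b0 (S k))).
      { intros s' t' h1 h2.
        destruct (excluded_middle_informative
          (P s' t' (side a0 (S k)) (side b0 (S k)))) as [h|h]; [exact h|].
        exfalso. apply hno. now exists (s', t'). }
      rewrite !hside in hchild.
      apply hsplit; apply hchild; lra. }
  pose (next := fun k p => proj1_sig (constructive_indefinite_description _ (hstep k p))).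
  pose (p := fix p k := match k with O => (s0, t0) | S k => next k (p k) end).
  assert (hp : forall k, ~ Q k (p k)).
  { induction k as [|k IH].
    - unfold Q, side; simpl. now rewrite !Rdiv_1_r.
    - simpl. unfold next.
      destruct (constructive_indefinite_description _ (hstep k (p k))) as [q hq]; simpl.
      now apply hq. }
  assert (hnest : forall k,
      (fst (p k) <= fst (p (S k)) /\
       fst (p (S k)) + side a0 (S k) <= fst (p k) + side a0 k) /\
      (snd (p k) <= snd (p (S k)) /\
       snd (p (S k)) + side b0 (S k) <= snd (p k) + side b0 k)).
  { intros k. simpl p. unfold next.
    destruct (constructive_indefinite_description _ (hstep k (p k))) as [q hq]; simpl.
    now apply hq. }
  destruct (nested_dyadic_intervals (fun k => fst (p k)) a0 ha) as [u hu].
  { intros k. apply hnest. }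
  destruct (nested_dyadic_intervals (fun k => snd (p k)) b0 hb) as [v hv].
  { intros k. apply hnest. }
  destruct (hloc u v) as [d [hd hP]].
  { pose proof (hu 0%nat) as h. simpl in h. now rewrite Rdiv_1_r in h. }
  { pose proof (hv 0%nat) as h. simpl in h. now rewrite Rdiv_1_r in h. }
  assert (hsmall : forall c, 0 < c -> exists N, forall k, (N <= k)%nat -> side c k < d).
  { intros c hc.
    destruct (pow_lt_1_zero (/ 2) ltac:(rewrite Rabs_pos_eq; lra) (d / c)
      ltac:(apply Rdiv_lt_0_compat; lra)) as [N hN].
    exists N. intros k hk. specialize (hN k hk). unfold side.
    rewrite pow_inv Rabs_pos_eq in hN; [|apply Rlt_le, Rinv_0_lt_compat, pow_lt; lra].
    apply Rmult_lt_compat_l with (r := c) in hN; [|lra].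
    replace (c * (d / c)) with d in hN by (field; lra). exact hN. }
  destruct (hsmall a0 ha) as [N1 h1]. destruct (hsmall b0 hb) as [N2 h2].
  apply (hp (N1 + N2)%nat). unfold Q. apply hP.
  - split; [now apply hpos | apply h1; lia].
  - split; [now apply hpos | apply h2; lia].
  - apply hu.
  - apply hv.
Qed.

(** * Goursat's theorem for dyadic sums *)

Section Goursat.
Context {Y : NormedModule C_AbsRing}.

(** The left Riemann sum of [psi] over [[t, t + b]] with [2 ^ n] equal steps. The
    recursive form makes the sum over an interval split exactly into the sums over
    its halves, with no limit and hence no completeness of [Y]. *)
Fixpoint dyadic_sum (n : nat) (psi : R -> Y) (t b : R) : Y :=
  match n with
  | O => scal (RtoC b) (psi t)
  | S n => plus (dyadic_sum n psi t (b / 2)) (dyadic_sum n psi (t + b / 2) (b / 2))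
  end.

Lemma dyadic_sum_minus n (f g : R -> Y) t b :
  dyadic_sum n (fun u => minus (f u) (g u)) t b
  = minus (dyadic_sum n f t b) (dyadic_sum n g t b).
Proof.
  revert t b. induction n as [|n IH]; intros t b; simpl.
  - now rewrite scal_minus_distr_l.
  - now rewrite !IH plus_minus_interchange.
Qed.

Lemma dyadic_sum_ext n (f g : R -> Y) t b :
  (forall u, f u = g u) -> dyadic_sum n f t b = dyadic_sum n g t b.
Proof.
  intros h. revert t b. induction n as [|n IH]; intros t b; simpl.
  - now rewrite h.
  - now rewrite !IH.
Qed.

Lemma dyadic_sum_near_const n (psi : R -> Y) (c : Y) (M t b : R) :
  0 <= b ->
  (forall u, t <= u <= t + b -> norm (minus (psi u) c) <= M) ->
  norm (minus (dyadic_sum n psi t b) (scal (RtoC b) c)) <= b * M.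
Proof.
  revert t b. induction n as [|n IH]; intros t b hb h; simpl.
  - rewrite -scal_minus_distr_l.
    rewrite norm_scal_C Cmod_R Rabs_pos_eq; [|lra].
    apply Rmult_le_compat_l; [lra|].
    apply h. lra.
  - replace (scal (RtoC b) c) with
      (plus (scal (RtoC (b / 2)) c) (scal (RtoC (b / 2)) c)).
    2:{ rewrite -scal_distr_r. f_equal.
        change (RtoC (b / 2) + RtoC (b / 2) = RtoC b)%C.
        rewrite -RtoC_plus. f_equal. lra. }
    rewrite plus_minus_interchange.
    eapply Rle_trans; [apply norm_triangle|].
    replace (b * M) with (b / 2 * M + b / 2 * M) by lra.
    apply Rplus_le_compat; apply IH; try lra; intros u hu; apply h; lra.
Qed.

Lemma norm_dyadic_sum n (psi : R -> Y) (M t b : R) :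
  0 <= b ->
  (forall u, t <= u <= t + b -> norm (psi u) <= M) ->
  norm (dyadic_sum n psi t b) <= b * M.
Proof.
  intros hb h.
  replace (dyadic_sum n psi t b)
    with (minus (dyadic_sum n psi t b) (scal (RtoC b) zero)).
  - apply dyadic_sum_near_const; [exact hb|]. intros u hu.
    rewrite minus_zero_r. now apply h.
  - now rewrite scal_zero_r minus_zero_r.
Qed.

(** The Riemann sum of the contour integral of [phi] along the boundary of
    [[s, s + a] x [t, t + b]], counterclockwise: along vertical edges the line
    element is [i dv], along horizontal ones [du]. The levels [m] and [n] are
    separate so that each direction can be bisected in turn. *)
Definition boundary_sum (m n : nat) (phi : C -> Y) (s t a b : R) : Y :=
  minus
    (scal Ci (minus (dyadic_sum m (fun v => phi (s + a, v)) t b)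
                    (dyadic_sum m (fun v => phi (s, v)) t b)))
    (minus (dyadic_sum n (fun u => phi (u, t + b)) s a)
           (dyadic_sum n (fun u => phi (u, t)) s a)).

Lemma boundary_sum_split_vertical m n (phi : C -> Y) s t a b :
  boundary_sum (S m) n phi s t a b =
  plus (boundary_sum m n phi s t a (b / 2))
       (boundary_sum m n phi s (t + b / 2) a (b / 2)).
Proof.
  unfold boundary_sum. simpl.
  replace (t + b / 2 + b / 2) with (t + b) by lra.
  rewrite plus_minus_interchange scal_distr_l.
  rewrite -plus_minus_interchange. f_equal.
  now rewrite plus_comm -minus_trans.
Qed.

Lemma boundary_sum_split_horizontal m n (phi : C -> Y) s t a b :
  boundary_sum m (S n) phi s t a b =
  plus (boundary_sum m n phi s t (a / 2) b)
       (boundary_sum m n phi (s + a / 2) t (a / 2) b).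
Proof.
  unfold boundary_sum. simpl.
  replace (s + a / 2 + a / 2) with (s + a) by lra.
  rewrite -plus_minus_interchange -scal_distr_l.
  f_equal; [f_equal|now rewrite plus_minus_interchange].
  now rewrite plus_comm -minus_trans.
Qed.

(** The sums over interior edges cancel exactly, whatever the level [n] is. *)
Lemma norm_boundary_sum_bisect n (phi : C -> Y) s t a b :
  norm (boundary_sum (S n) (S n) phi s t a b) <=
  norm (boundary_sum n n phi s t (a / 2) (b / 2)) +
  norm (boundary_sum n n phi (s + a / 2) t (a / 2) (b / 2)) +
  norm (boundary_sum n n phi s (t + b / 2) (a / 2) (b / 2)) +
  norm (boundary_sum n n phi (s + a / 2) (t + b / 2) (a / 2) (b / 2)).
Proof.
  rewrite boundary_sum_split_vertical !boundary_sum_split_horizontal.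
  eapply Rle_trans; [apply norm_triangle|].
  rewrite Rplus_assoc.
  apply Rplus_le_compat; apply norm_triangle.
Qed.

(** For an affine function the two differences between opposite edges are the
    constants [a l] and [i b l], so the boundary sum is exactly zero at every level,
    and only the remainder of the first order expansion at [(u, v)] contributes. *)
Lemma boundary_sum_small_near (phi : C -> Y) (u v : R) (l : Y) :
  is_derive (K := C_AbsRing) phi (u, v) l ->
  forall eps, 0 < eps -> exists d, 0 < d /\ forall n s t a b,
    0 < a < d -> 0 < b < d -> s <= u <= s + a -> t <= v <= t + b ->
    norm (boundary_sum n n phi s t a b) <= eps * (a + b) ^ 2.
Proof.
  intros hl eps heps.
  destruct (is_derive_two_points phi (u, v) l hl (eps / 2) ltac:(lra)) as [d [hd h]].
  exists (d / 2). split; [lra|]. intros n s t a b ha hb hu hv.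
  assert (hdist : forall x y, s <= x <= s + a -> t <= y <= t + b ->
      Cmod ((x, y) - (u, v)) <= a + b).
  { intros x y hx hy.
    change ((x, y) - (u, v))%C with (x - u, y - v).
    eapply Rle_trans; [apply Cmod_le_Rabs_plus|].
    pose proof (Rabs_le (x - u) a ltac:(lra)). pose proof (Rabs_le (y - v) b ltac:(lra)).
    lra. }
  assert (hpair : forall x y x' y', s <= x <= s + a -> t <= y <= t + b ->
      s <= x' <= s + a -> t <= y' <= t + b ->
      norm (minus (minus (phi (x', y')) (phi (x, y))) (scal ((x', y') - (x, y))%C l))
        <= eps * (a + b)).
  { intros x y x' y' hx hy hx' hy'.
    pose proof (hdist x y hx hy). pose proof (hdist x' y' hx' hy').
    eapply Rle_trans; [apply h; lra|].
    replace (eps * (a + b)) with (eps / 2 * ((a + b) + (a + b))) by lra.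
    apply Rmult_le_compat_l; lra. }
  unfold boundary_sum. rewrite -!dyadic_sum_minus.
  match goal with |- norm (minus (scal _ ?A) ?B) <= _ => set (V := A); set (H := B) end.
  assert (hV : norm (minus V (scal (RtoC b) (scal (RtoC a) l))) <= b * (eps * (a + b))).
  { apply dyadic_sum_near_const; [lra|]. intros y hy.
    replace (RtoC a) with (((s + a)%R, y) - (s, y))%C
      by (apply injective_projections; simpl; ring).
    apply hpair; lra. }
  assert (hH : norm (minus H (scal (RtoC a) (scal (Ci * RtoC b)%C l)))
      <= a * (eps * (a + b))).
  { apply dyadic_sum_near_const; [lra|]. intros x hx.
    replace (Ci * RtoC b)%C with ((x, (t + b)%R) - (x, t))%C
      by (apply injective_projections; simpl; ring).
    apply hpair; lra. }
  assert (heq : scal (RtoC a) (scal (Ci * RtoC b)%C l)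
    = scal Ci (scal (RtoC b) (scal (RtoC a) l))).
  { rewrite !scal_assoc. f_equal.
    apply Cmult_comm. }
  rewrite heq in hH. set (c := scal (RtoC b) (scal (RtoC a) l)) in *.
  pose proof (norm_minus_trans (V := Y) (scal Ci V) (scal Ci c) H) as htri.
  assert (h1 : norm (minus (scal Ci V) (scal Ci c)) <= norm (minus V c)).
  { rewrite -scal_minus_distr_l norm_scal_C Cmod_Ci Rmult_1_l. apply Rle_refl. }
  rewrite norm_minus_sym in hH.
  eapply Rle_trans; [exact htri|].
  replace (eps * (a + b) ^ 2) with (b * (eps * (a + b)) + a * (eps * (a + b))) by ring.
  apply Rplus_le_compat; [eapply Rle_trans; [exact h1 | exact hV] | exact hH].
Qed.

(** Goursat's theorem. The bound [e * (a + b) ^ 2] is additive under bisection, as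
    the four quarters each have half the perimeter; each bisection costs one level. *)
Lemma boundary_sum_tends_to_zero (phi : C -> Y) (s t a b : R) :
  0 < a -> 0 < b ->
  (forall u v, s <= u <= s + a -> t <= v <= t + b ->
     exists l, is_derive (K := C_AbsRing) phi (u, v) l) ->
  forall eps, 0 < eps -> exists n, norm (boundary_sum n n phi s t a b) <= eps.
Proof.
  intros ha hb hphi eps heps.
  set (e := eps / (a + b) ^ 2).
  assert (hab : 0 < (a + b) ^ 2) by (apply pow_lt; lra).
  assert (he : 0 < e) by (apply Rdiv_lt_0_compat; lra).
  destruct (rectangle_bisection (fun s t a b => exists N, forall n, (N <= n)%nat ->
    norm (boundary_sum n n phi s t a b) <= e * (a + b) ^ 2) s t a b ha hb) as [N hN].
  - intros s' t' a' b' [N1 h1] [N2 h2] [N3 h3] [N4 h4].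
    exists (S (N1 + N2 + N3 + N4)). intros [|n] hn; [lia|].
    specialize (h1 n ltac:(lia)). specialize (h2 n ltac:(lia)).
    specialize (h3 n ltac:(lia)). specialize (h4 n ltac:(lia)).
    pose proof (norm_boundary_sum_bisect n phi s' t' a' b') as h.
    replace (e * (a' + b') ^ 2) with (4 * (e * (a' / 2 + b' / 2) ^ 2)) by field.
    lra.
  - intros u v hu hv. destruct (hphi u v hu hv) as [l hl].
    destruct (boundary_sum_small_near phi u v l hl e he) as [d [hd h]].
    exists d. split; [exact hd|]. intros. exists 0%nat. intros n _. now apply h.
  - exists N. eapply Rle_trans; [now apply hN|]. unfold e. right. field. lra.
Qed.

End Goursat.

(** * The complex exponential *)

Lemma exp_nondecreasing (x y : R) : x <= y -> exp x <= exp y.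
Proof.
  intros [h| ->]; [now apply Rlt_le, exp_increasing | apply Rle_refl].
Qed.

Definition Cexp (z : C) : C := (exp (fst z) * cos (snd z), exp (fst z) * sin (snd z)).

Lemma Cexp_plus z w : Cexp (z + w) = (Cexp z * Cexp w)%C.
Proof.
  destruct z as [x y], w as [u v]. unfold Cexp; simpl.
  rewrite exp_plus cos_plus sin_plus.
  apply injective_projections; simpl; ring.
Qed.

Lemma Cexp_0 : Cexp 0 = 1%C.
Proof.
  unfold Cexp; simpl. rewrite exp_0 cos_0 sin_0.
  apply injective_projections; simpl; ring.
Qed.

Lemma Cexp_opp_l z : (Cexp (- z) * Cexp z = 1)%C.
Proof. rewrite -Cexp_plus. replace (- z + z)%C with (RtoC 0) by ring. apply Cexp_0. Qed.

Lemma Cmod_Cexp z : Cmod (Cexp z) = exp (fst z).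
Proof.
  unfold Cmod, Cexp; simpl.
  pose proof (sin2_cos2 (snd z)) as h. unfold Rsqr in h.
  match goal with |- sqrt ?A = _ =>
    replace A with (exp (fst z) * exp (fst z) *
      (sin (snd z) * sin (snd z) + cos (snd z) * cos (snd z))) by ring end.
  rewrite h Rmult_1_r. apply sqrt_square, Rlt_le, exp_pos.
Qed.

(** Both components follow from the real derivatives of [exp], [sin] and [cos] at
    [0], through [e^x cos y - 1 - x = e^x (cos y - 1) + (e^x - 1 - x)] and
    [e^x sin y - y = e^x (sin y - y) + (e^x - 1) y]. *)
Lemma Cexp_expansion_at_zero eps : 0 < eps ->
  exists d, 0 < d /\ forall z, Cmod z < d -> Cmod (Cexp z - 1 - z) <= eps * Cmod z.
Proof.
  intros heps.
  (* The two components contribute at most six times [e * Cmod z] in total. *)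
  set (e := Rmin (eps / 8) 1).
  assert (he : 0 < e) by (apply Rmin_glb_lt; lra).
  assert (he8 : e <= eps / 8) by apply Rmin_l.
  assert (he1 : e <= 1) by apply Rmin_r.
  destruct (derivable_pt_lim_expansion exp 0 _ (derivable_pt_lim_exp 0) e he) as [d1 [hd1 h1]].
  destruct (derivable_pt_lim_expansion sin 0 _ (derivable_pt_lim_sin 0) e he) as [d2 [hd2 h2]].
  destruct (derivable_pt_lim_expansion cos 0 _ (derivable_pt_lim_cos 0) e he) as [d3 [hd3 h3]].
  rewrite exp_0 in h1. rewrite sin_0 cos_0 in h2. rewrite sin_0 cos_0 in h3.
  exists (Rmin (Rmin d1 d2) (Rmin d3 (e / 2))). split.
  { repeat apply Rmin_glb_lt; lra. }
  intros [x y] hz.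
  pose proof (Rmin_l (Rmin d1 d2) (Rmin d3 (e / 2))).
  pose proof (Rmin_r (Rmin d1 d2) (Rmin d3 (e / 2))).
  pose proof (Rmin_l d1 d2). pose proof (Rmin_r d1 d2).
  pose proof (Rmin_l d3 (e / 2)). pose proof (Rmin_r d3 (e / 2)).
  pose proof (Rmax_Cmod (x, y)) as hmax. simpl in hmax.
  pose proof (Rmax_l (Rabs x) (Rabs y)). pose proof (Rmax_r (Rabs x) (Rabs y)).
  set (m := Cmod (x, y)) in *.
  specialize (h1 x ltac:(lra)). specialize (h2 y ltac:(lra)). specialize (h3 y ltac:(lra)).
  rewrite !Rplus_0_l Rmult_1_l in h1. rewrite !Rplus_0_l in h2. rewrite !Rplus_0_l in h3.
  replace (sin y - 0 - 1 * y) with (sin y - y) in h2 by ring.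
  replace (cos y - 1 - - 0 * y) with (cos y - 1) in h3 by ring.
  assert (hex : Rabs (exp x - 1) <= e).
  { replace (exp x - 1) with ((exp x - 1 - x) + x) by ring.
    eapply Rle_trans; [apply Rabs_triang|]. pose proof (Rabs_pos x). nra. }
  assert (hex2 : exp x <= 2) by (pose proof (Rle_abs (exp x - 1)); lra).
  pose proof (exp_pos x) as hex0.
  replace (Cexp (x, y) - 1 - (x, y))%C with
    (exp x * (cos y - 1) + (exp x - 1 - x), exp x * (sin y - y) + (exp x - 1) * y).
  2:{ apply injective_projections; simpl; ring. }
  eapply Rle_trans; [apply Cmod_le_Rabs_plus|].
  pose proof (Rabs_triang (exp x * (cos y - 1)) (exp x - 1 - x)) as hr.
  pose proof (Rabs_triang (exp x * (sin y - y)) ((exp x - 1) * y)) as hi.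
  rewrite !Rabs_mult (Rabs_pos_eq (exp x)) in hr; [|lra].
  rewrite !Rabs_mult (Rabs_pos_eq (exp x)) in hi; [|lra].
  pose proof (Rabs_pos x). pose proof (Rabs_pos y).
  pose proof (Rabs_pos (cos y - 1)). pose proof (Rabs_pos (sin y - y)).
  pose proof (Rabs_pos (exp x - 1)).
  assert (e * Rabs x <= e * m) by (apply Rmult_le_compat_l; lra).
  assert (e * Rabs y <= e * m) by (apply Rmult_le_compat_l; lra).
  assert (exp x * Rabs (cos y - 1) <= 2 * (e * m)) by (apply Rmult_le_compat; lra).
  assert (exp x * Rabs (sin y - y) <= 2 * (e * m)) by (apply Rmult_le_compat; lra).
  assert (Rabs (exp x - 1) * Rabs y <= e * m) by (apply Rmult_le_compat; lra).
  assert (e * m <= eps / 8 * m) by (apply Rmult_le_compat_r; lra).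
  assert (0 <= eps * m) by (apply Rmult_le_pos; lra).
  lra.
Qed.

Lemma is_derive_Cexp z : is_derive (K := C_AbsRing) (V := AbsRing_NormedModule C_AbsRing) Cexp z (Cexp z).
Proof.
  apply is_derive_C_intro. intros eps heps.
  assert (hpos : 0 < Cmod (Cexp z)) by (rewrite Cmod_Cexp; apply exp_pos).
  destruct (Cexp_expansion_at_zero (eps / Cmod (Cexp z))) as [d [hd h]].
  { now apply Rdiv_lt_0_compat. }
  exists d. split; [exact hd|]. intros w hw. specialize (h (w - z)%C hw).
  change (Cmod (Cexp w - Cexp z - (w - z) * Cexp z) <= eps * Cmod (w - z)).
  replace (Cexp w) with (Cexp (w - z) * Cexp z)%C
    by (rewrite -Cexp_plus; f_equal; ring).
  replace (Cexp (w - z) * Cexp z - Cexp z - (w - z) * Cexp z)%C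
    with (Cexp z * (Cexp (w - z) - 1 - (w - z)))%C by ring.
  rewrite Cmod_mult.
  apply Rmult_le_compat_l with (r := Cmod (Cexp z)) in h; [|lra].
  eapply Rle_trans; [exact h|]. right. field. lra.
Qed.

Lemma is_derive_scal_fct_C {Y : NormedModule C_AbsRing} (u : C -> C) (f : C -> Y) z du df :
  is_derive (K := C_AbsRing) (V := AbsRing_NormedModule C_AbsRing) u z du ->
  is_derive (K := C_AbsRing) f z df ->
  is_derive (K := C_AbsRing) (fun w => scal (u w) (f w)) z
    (plus (scal du (f z)) (scal (u z) df)).
Proof.
  intros hu hf. eapply filterdiff_ext_lin.
  - apply (filterdiff_scal_fct (K := C_AbsRing) (U := AbsRing_NormedModule C_AbsRing) (V := Y)
      z u f (fun t => scal t du) (fun t => scal t df)); [|exact hu|exact hf].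
    apply Cmult_comm.
  - intros t. simpl. rewrite scal_distr_l !scal_assoc. f_equal.
    f_equal. apply Cmult_comm.
Qed.

(** The quotient [(g x - c) / x] in the logarithmic coordinate [w], [x = Cexp w]. *)
Lemma is_derive_log_quotient {Y : NormedModule C_AbsRing} (g : C -> Y) (c : Y) (z : C) (l : Y) :
  is_derive (K := C_AbsRing) g (Cexp z) l ->
  exists l', is_derive (K := C_AbsRing)
    (fun w : C => scal (Cexp (- w)) (minus (g (Cexp w)) c)) z l'.
Proof.
  intros hg.
  assert (hu : is_derive (K := C_AbsRing) (V := AbsRing_NormedModule C_AbsRing)
    (fun w => Cexp (- w)) z (scal (opp one : C_AbsRing) (Cexp (- z)))).
  { apply (is_derive_comp (V := AbsRing_NormedModule C_AbsRing) Cexp Copp);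
      [apply is_derive_Cexp|].
    apply (is_derive_opp (V := AbsRing_NormedModule C_AbsRing) (fun w => w)).
    apply is_derive_id. }
  assert (hf : is_derive (K := C_AbsRing) (fun w : C => minus (g (Cexp w)) c) z
    (minus (scal (Cexp z : C_AbsRing) l) zero)).
  { apply (is_derive_minus (V := Y) (fun w : C => g (Cexp w)) (fun _ => c)).
    - apply (is_derive_comp (V := Y) g Cexp); [exact hg | apply is_derive_Cexp].
    - apply (is_derive_const (V := Y)). }
  eexists. exact (is_derive_scal_fct_C _ _ z _ _ hu hf).
Qed.

(** * Cauchy's estimate *)

(** In the coordinate [w = s + i t] with [x = Cexp w], the quotient
    [phi w = (g x - g 0) / x] is holomorphic and [2 pi i]-periodic, so on a
    rectangle of height [2 pi] the horizontal edges cancel and Goursat's theorem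
    says that the sums of [phi] over the two vertical edges, which are circles
    around [0], agree up to an arbitrarily small error. On the outer circle [phi] is
    bounded by [M / rho]; on a small inner one it is close to [l]. *)
Lemma cauchy_estimate {Y : NormedModule C_AbsRing} (g : C -> Y) (rho M : R) (l : Y) :
  0 < rho ->
  (forall x : C, Cmod x <= rho -> exists l', is_derive (K := C_AbsRing) g x l') ->
  is_derive (K := C_AbsRing) g (RtoC 0) l ->
  (forall x : C, Cmod x = rho -> norm (minus (g x) (g (RtoC 0))) <= M) ->
  norm l <= M / rho.
Proof.
  intros hrho hg hl hM.
  set (phi := fun w : C => scal (Cexp (- w)) (minus (g (Cexp w)) (g (RtoC 0)))).
  apply le_epsilon. intros e he.
  destruct (is_derive_two_points g (RtoC 0) l hl (e / 2) ltac:(lra)) as [d [hd hd']].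
  (* Logarithm of the inner radius: the expansion of [g] at [0] must apply there, and
     the rectangle must have positive width. *)
  set (s := Rmin (ln (d / 2)) (ln rho - 1)).
  assert (hsd : exp s < d).
  { apply Rle_lt_trans with (exp (ln (d / 2))).
    - apply exp_nondecreasing, Rmin_l.
    - rewrite exp_ln; lra. }
  assert (hs : s <= ln rho - 1) by apply Rmin_r.
  set (a := ln rho - s).
  assert (hinner : forall v, norm (minus (phi (s, v)) l) <= e / 2).
  { intros v. specialize (hd' (RtoC 0) (Cexp (s, v))).
    assert (hE : Cmod (Cexp (s, v) - 0) = exp s).
    { replace (Cexp (s, v) - 0)%C with (Cexp (s, v)) by ring. apply Cmod_Cexp. }
    replace (0 - 0)%C with (RtoC 0) in hd' by ring. rewrite hE Cmod_0 Rplus_0_l in hd'.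
    specialize (hd' hd hsd).
    replace (minus (phi (s, v)) l) with (scal (Cexp (- (s, v)))
      (minus (minus (g (Cexp (s, v))) (g (RtoC 0))) (scal (Cexp (s, v) - 0)%C l))).
    - rewrite norm_scal_C Cmod_Cexp. simpl fst.
      apply Rmult_le_compat_l with (r := exp (- s)) in hd'; [|apply Rlt_le, exp_pos].
      eapply Rle_trans; [exact hd'|].
      replace (exp (- s) * (e / 2 * exp s)) with (e / 2 * (exp (- s + s))) by (rewrite exp_plus; ring).
      rewrite Rplus_opp_l exp_0. lra.
    - rewrite scal_minus_distr_l scal_assoc. unfold phi. f_equal.
      replace (mult (Cexp (- (s, v))) (Cexp (s, v) - 0)%C) with (one : C_AbsRing);
        [apply scal_one|].
      change (RtoC 1 = Cexp (- (s, v)) * (Cexp (s, v) - 0))%C.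
      rewrite -(Cexp_opp_l (s, v)). ring. }
  assert (houter : forall v, norm (phi (ln rho, v)) <= M / rho).
  { intros v. unfold phi. rewrite norm_scal_C Cmod_Cexp. simpl fst.
    rewrite exp_Ropp exp_ln //. unfold Rdiv. rewrite Rmult_comm.
    apply Rmult_le_compat_r; [apply Rlt_le, Rinv_0_lt_compat; lra|].
    apply hM. rewrite Cmod_Cexp. simpl. now apply exp_ln. }
  pose proof PI_RGT_0 as hpi.
  destruct (boundary_sum_tends_to_zero phi s 0 a (2 * PI)) with (eps := PI * e) as [n hn].
  { unfold a. lra. }
  { lra. }
  { intros u v hu _. destruct (hg (Cexp (u, v))) as [l' hl'].
    - rewrite Cmod_Cexp. simpl. rewrite -(exp_ln rho) //.
      apply exp_nondecreasing. unfold a in hu. lra.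
    - eapply is_derive_log_quotient. exact hl'. }
  { apply Rmult_lt_0_compat; lra. }
  unfold boundary_sum in hn.
  (* By periodicity the two horizontal edges carry the same sum. *)
  rewrite (dyadic_sum_ext n (fun u => phi (u, 0 + 2 * PI)) (fun u => phi (u, 0))) in hn; last first.
  { intros u.
    unfold phi, Cexp. simpl.
    rewrite Rplus_0_l Ropp_0 cos_neg sin_neg cos_2PI sin_2PI cos_0 sin_0 Ropp_0. reflexivity. }
  rewrite minus_eq_zero minus_zero_r norm_scal_C Cmod_Ci Rmult_1_l in hn.
  replace (s + a) with (ln rho) in hn by (unfold a; ring).
  set (V2 := dyadic_sum n (fun v => phi (ln rho, v)) 0 (2 * PI)) in hn.
  set (V1 := dyadic_sum n (fun v => phi (s, v)) 0 (2 * PI)) in hn.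
  assert (h1 : norm (minus V1 (scal (RtoC (2 * PI)) l)) <= 2 * PI * (e / 2)).
  { apply dyadic_sum_near_const; [lra|]. intros v _. apply hinner. }
  assert (h2 : norm V2 <= 2 * PI * (M / rho)).
  { apply norm_dyadic_sum; [lra|]. intros v _. apply houter. }
  pose proof (norm_minus_trans (V := Y) V2 V1 (scal (RtoC (2 * PI)) l)) as h3.
  pose proof (norm_triangle_inv (V := Y) (scal (RtoC (2 * PI)) l) V2) as h4.
  rewrite norm_minus_sym in h3.
  rewrite norm_scal_C Cmod_R (Rabs_pos_eq (2 * PI)) in h4; [|lra].
  apply Rmult_le_reg_l with (2 * PI); [lra|].
  pose proof (Rle_abs (2 * PI * norm l - norm V2)).
  lra.
Qed.

(** * The Fréchet differential and mean value inequalities *)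

Section HardyLittlewood.
Context {X Y : NormedModule C_AbsRing}.

Lemma opnorm_nonneg (l : X -> Y) : 0 <= opnorm l.
Proof.
  unfold opnorm.
  destruct (Lub_Rbar_correct (fun r => exists zeta : X, norm zeta = 1 /\ r = norm (l zeta)))
    as [hub hlub].
  destruct (Lub_Rbar _) as [r| |]; simpl; try lra.
  apply Rnot_lt_le. intros hr.
  apply (hlub m_infty).
  intros x [zeta [h1 ->]].
  specialize (hub (norm (l zeta)) (ex_intro _ zeta (conj h1 eq_refl))). simpl in hub.
  pose proof (norm_ge_0 (l zeta)). lra.
Qed.

(** The hypothesis [0 <= B] covers the zero space, where there is no unit vector
    and [opnorm] is [0]. *)
Lemma opnorm_le (l : X -> Y) (B : R) : 0 <= B ->
  (forall zeta, norm zeta = 1 -> norm (l zeta) <= B) -> opnorm l <= B.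
Proof.
  intros hB h. unfold opnorm.
  destruct (Lub_Rbar_correct (fun r => exists zeta : X, norm zeta = 1 /\ r = norm (l zeta)))
    as [_ hlub].
  specialize (hlub B). destruct (Lub_Rbar _) as [r| |]; simpl; try lra.
  apply hlub. intros x [zeta [h1 ->]]. simpl. now apply h.
Qed.

(** Boundedness of [l] makes the supremum finite, so that [real] does not lose it. *)
Lemma norm_le_opnorm (l : X -> Y) (x : X) : is_linear l -> norm (l x) <= opnorm l * norm x.
Proof.
  intros hl. destruct (Req_dec (norm x) 0) as [h0|h0].
  { rewrite (norm_eq_zero x h0) linear_zero // norm_zero norm_zero. lra. }
  assert (hx : 0 < norm x) by (pose proof (norm_ge_0 x); lra).
  set (u := scal (RtoC (/ norm x)) x).
  assert (hu : norm u = 1).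
  { unfold u. rewrite norm_scal_C Cmod_R Rabs_pos_eq; [|now apply Rlt_le, Rinv_0_lt_compat].
    field. lra. }
  assert (hlu : norm (l u) <= opnorm l).
  { destruct (linear_norm _ hl) as [M [hM hbound]]. unfold opnorm.
    destruct (Lub_Rbar_correct (fun r => exists zeta : X, norm zeta = 1 /\ r = norm (l zeta)))
      as [hub hlub].
    specialize (hub (norm (l u)) (ex_intro _ u (conj hu eq_refl))).
    destruct (Lub_Rbar _) as [r| |]; simpl; [exact hub| |easy].
    destruct (hlub M). intros y [zeta [h1 ->]]. simpl.
    specialize (hbound zeta). now rewrite h1 Rmult_1_r in hbound. }
  unfold u in hlu. rewrite linear_scal // norm_scal_C Cmod_R Rabs_pos_eq in hlu;
    [|now apply Rlt_le, Rinv_0_lt_compat].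
  apply Rmult_le_compat_r with (r := norm x) in hlu; [|lra].
  replace (/ norm x * norm (l x) * norm x) with (norm (l x)) in hlu by (field; lra).
  exact hlu.
Qed.

Lemma frechet_spec (f : X -> Y) (z : X) :
  (exists l, filterdiff f (locally z) l) -> filterdiff f (locally z) (frechet f z).
Proof. apply epsilon_spec. Qed.

(** Mean value inequality for a curve whose speed is locally at most [h']. The bound
    with [h t + e * t] in place of [h t] holds between any [t] and all nearby points,
    so the supremum of the points that satisfy it relative to [a] belongs to the set
    and cannot lie before [b]. A varying [h'] is needed because the speed blows up
    towards the boundary of the ball. *)
Lemma norm_increment_le (g : R -> Y) (h : R -> R) (a b : R) : a <= b ->
  (forall t, a <= t <= b -> exists m, derivable_pt_lim h t m /\
     forall e, 0 < e -> exists d, 0 < d /\ forall s, Rabs (s - t) < d ->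
       norm (minus (g s) (g t)) <= (m + e) * Rabs (s - t)) ->
  norm (minus (g b) (g a)) <= h b - h a.
Proof.
  intros hab hloc. apply le_epsilon. intros e0 he0.
  (* The summand 1 keeps the denominator positive when [a = b]. *)
  set (e := e0 / (b - a + 1)).
  assert (he : 0 < e) by (apply Rdiv_lt_0_compat; lra).
  set (H := fun t => h t + e * t).
  assert (hH : H b - H a <= h b - h a + e0).
  { unfold H. assert (e * (b - a) <= e0); [|lra].
    replace e0 with (e * (b - a + 1)) by (unfold e; field; lra).
    apply Rmult_le_compat_l; lra. }
  eapply Rle_trans; [|exact hH]. clear hH.
  assert (hl : forall t, a <= t <= b -> exists d, 0 < d /\ forall s, Rabs (s - t) < d ->
    (t <= s -> norm (minus (g s) (g t)) <= H s - H t) /\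
    (s <= t -> norm (minus (g t) (g s)) <= H t - H s)).
  { intros t ht. destruct (hloc t ht) as [m [hm hg]].
    destruct (hg (e / 2) ltac:(lra)) as [d1 [hd1 h1]].
    destruct (derivable_pt_lim_expansion h t m hm (e / 2) ltac:(lra)) as [d2 [hd2 h2]].
    exists (Rmin d1 d2). split; [now apply Rmin_glb_lt|]. intros s hs.
    pose proof (Rmin_l d1 d2). pose proof (Rmin_r d1 d2).
    specialize (h1 s ltac:(lra)). specialize (h2 (s - t) ltac:(lra)).
    replace (t + (s - t)) with s in h2 by ring.
    pose proof (Rle_abs (h s - h t - m * (s - t))) as h3.
    pose proof (Rle_abs (- (h s - h t - m * (s - t)))) as h4. rewrite Rabs_Ropp in h4.
    unfold H. split; intros hst.
    - rewrite (Rabs_pos_eq (s - t)) in h1; [|lra].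
      rewrite (Rabs_pos_eq (s - t)) in h2; [|lra]. lra.
    - rewrite norm_minus_sym. rewrite (Rabs_left1 (s - t)) in h1; [|lra].
      rewrite (Rabs_left1 (s - t)) in h2; [|lra]. lra. }
  set (E := fun x => a <= x <= b /\ norm (minus (g x) (g a)) <= H x - H a).
  assert (hEa : E a).
  { split; [lra|]. rewrite minus_eq_zero norm_zero. lra. }
  destruct (completeness E) as [c [hub hlub]].
  { exists b. intros x hx. apply hx. }
  { now exists a. }
  assert (hca : a <= c) by now apply hub.
  assert (hcb : c <= b) by (apply hlub; intros x hx; apply hx).
  destruct (hl c ltac:(lra)) as [d [hd hdc]].
  assert (hEc : E c).
  { destruct (excluded_middle_informative (exists x, E x /\ c - d < x)) as [[x [hx hxc]]|hno].
    - split; [lra|]. pose proof (hub x hx) as hxle.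
      destruct (hdc x) as [_ h2]; [apply Rabs_lt_between; lra|].
      pose proof (norm_minus_trans (V := Y) (g c) (g x) (g a)) as h3.
      specialize (h2 hxle). destruct hx as [_ hx]. lra.
    - exfalso. assert (c <= c - d); [|lra]. apply hlub. intros x hx.
      apply Rnot_lt_le. intros hlt. apply hno. now exists x. }
  destruct (Rle_lt_or_eq_dec c b hcb) as [hlt|heq].
  - exfalso. set (x := Rmin (c + d / 2) b).
    assert (hx : c < x <= b).
    { split; [apply Rmin_glb_lt; lra | apply Rmin_r]. }
    assert (hxd : x <= c + d / 2) by apply Rmin_l.
    destruct (hdc x) as [h1 _]; [apply Rabs_lt_between; lra|].
    specialize (h1 ltac:(lra)).
    assert (x <= c); [|lra]. apply hub. split; [lra|].
    pose proof (norm_minus_trans (V := Y) (g x) (g c) (g a)) as h3.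
    destruct hEc as [_ hEc]. lra.
  - rewrite heq in hEc. apply hEc.
Qed.

Lemma is_derive_along_line (f : X -> Y) (p q : X) (x : C) (l : X -> Y) :
  filterdiff f (locally (plus p (scal x q))) l ->
  is_derive (K := C_AbsRing) (fun w : C => f (plus p (scal w q))) x (l q).
Proof.
  intros hf. eapply filterdiff_ext_lin.
  - apply (filterdiff_comp' (K := C_AbsRing) (U := AbsRing_NormedModule C_AbsRing)
      (fun w => plus p (scal w q)) f x (fun w => scal w q) l); [|exact hf].
    eapply filterdiff_ext_lin.
    + apply (filterdiff_plus_fct (K := C_AbsRing) (U := AbsRing_NormedModule C_AbsRing)
        (fun _ => p) (fun w => scal w q) (fun _ => zero) (fun w => scal w q)).
      * apply filterdiff_const.
      * apply filterdiff_scal_l.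
    + intros y. apply @plus_zero_l.
  - intros y. simpl. apply linear_scal. apply hf.
Qed.
Lemma is_derive_real_increment (g : C -> Y) (t : R) (l : Y) :
  is_derive (K := C_AbsRing) g (RtoC t) l ->
  forall e, 0 < e -> exists d, 0 < d /\ forall s : R, Rabs (s - t) < d ->
    norm (minus (g (RtoC s)) (g (RtoC t))) <= (norm l + e) * Rabs (s - t).
Proof.
  intros hg e he. destruct (is_derive_two_points g (RtoC t) l hg e he) as [d [hd h]].
  exists d. split; [exact hd|]. intros s hs. specialize (h (RtoC t) (RtoC s)).
  rewrite -!RtoC_minus !Cmod_R Rminus_diag Rabs_R0 Rplus_0_l in h. specialize (h hd hs).
  pose proof (norm_minus_trans (V := Y) (minus (g (RtoC s)) (g (RtoC t)))
    (scal (RtoC (s - t)) l) zero) as h1.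
  rewrite !minus_zero_r norm_scal_C Cmod_R in h1. lra.
Qed.

Lemma norm_segment_increment_le (f : X -> Y) (hf : analytic_on_ball f)
    (p q : X) (h : R -> R) (a b : R) : a <= b ->
  (forall t, a <= t <= b -> unit_ball (plus p (scal (RtoC t) q)) /\
    exists m, derivable_pt_lim h t m /\
      opnorm (frechet f (plus p (scal (RtoC t) q))) * norm q <= m) ->
  norm (minus (f (plus p (scal (RtoC b) q))) (f (plus p (scal (RtoC a) q)))) <= h b - h a.
Proof.
  intros hab hpath.
  apply (norm_increment_le (fun t => f (plus p (scal (RtoC t) q)))); [exact hab|].
  intros t ht. destruct (hpath t ht) as [hball [m [hm hle]]].
  exists m. split; [exact hm|]. intros e he.
  pose proof (frechet_spec f _ (hf _ hball)) as hd.
  destruct (is_derive_real_increment (fun w => f (plus p (scal w q))) t _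
    (is_derive_along_line f p q (RtoC t) _ hd) e he) as [d [hd0 hinc]].
  exists d. split; [exact hd0|]. intros s hs.
  eapply Rle_trans; [now apply hinc|].
  apply Rmult_le_compat_r; [apply Rabs_pos|].
  pose proof (norm_le_opnorm _ q (proj1 hd)). lra.
Qed.

(** * The two implications *)

Lemma Rpower_antitone (c x y : R) : c <= 0 -> 0 < x <= y -> Rpower y c <= Rpower x c.
Proof.
  intros hc [hx hxy]. unfold Rpower. apply exp_nondecreasing.
  assert (ln x <= ln y) by (now apply ln_le). nra.
Qed.

Lemma Rpower_minus_1 (x a : R) : 0 < x -> Rpower x (a - 1) = Rpower x a / x.
Proof. intros hx. unfold Rminus. now rewrite Rpower_plus Rpower_Ropp Rpower_1. Qed.

Lemma Rpower_pos (x a : R) : 0 < Rpower x a.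
Proof. apply exp_pos. Qed.

Lemma rpow_pos_eq (x a : R) : 0 < x -> rpow x a = Rpower x a.
Proof. intros hx. unfold rpow. destruct (Rlt_dec 0 x); [reflexivity | lra]. Qed.

Lemma rpow_nonneg (x a : R) : 0 <= rpow x a.
Proof. unfold rpow. destruct (Rlt_dec 0 x); [apply Rlt_le, Rpower_pos | lra]. Qed.

(** Seen at the centre of the ball, where the weight is [1]. *)
Lemma differential_bound_nonneg alpha (f : X -> Y) (C : R) :
  differential_bound alpha f C -> 0 <= C.
Proof.
  intros h. specialize (h zero). unfold unit_ball in h.
  rewrite norm_zero Rminus_0_r rpow_pos_eq in h; [|lra].
  unfold Rpower in h. rewrite ln_1 Rmult_0_r exp_0 in h.
  pose proof (opnorm_nonneg (frechet f zero)). specialize (h ltac:(lra)). lra.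
Qed.

(** The weight decreases with the distance [1 - norm x] to the unit sphere. *)
Lemma differential_bound_depth alpha (halpha : alpha < 1) (f : X -> Y) (C : R) :
  differential_bound alpha f C ->
  forall (x : X) (t : R), 0 < t -> norm x <= 1 - t ->
    opnorm (frechet f x) <= C * Rpower t (alpha - 1).
Proof.
  intros h x t ht hx. pose proof (differential_bound_nonneg _ _ _ h) as hC.
  eapply Rle_trans; [apply h; unfold unit_ball; lra|].
  rewrite rpow_pos_eq; [|lra]. apply Rmult_le_compat_l; [exact hC|].
  apply Rpower_antitone; lra.
Qed.

Lemma norm_line_to_origin (z : X) (t : R) : t <= 1 -> unit_ball z ->
  norm (plus z (scal (RtoC t) (opp z))) <= 1 - t.
Proof.
  intros ht hz. unfold unit_ball in hz.
  replace (plus z (scal (RtoC t) (opp z))) with (scal (RtoC (1 - t)) z).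
  - rewrite norm_scal_C Cmod_R Rabs_pos_eq; [|lra]. nra.
  - rewrite RtoC_minus. rewrite (scal_minus_distr_r (one : C_AbsRing) (RtoC t : C_AbsRing) z).
    now rewrite scal_one scal_opp_r.
Qed.

(** Along [t |-> (1 - t) z] the depth is at least [t], so the speed is at most
    [C * t ^ (alpha - 1)], with primitive [C / alpha * t ^ alpha]. As that primitive
    is not differentiable at [0], the bound is proved on [[s, t0]] and [s] tends to [0]. *)
Lemma radial_increment alpha (halpha : 0 < alpha < 1) (f : X -> Y)
    (hf : analytic_on_ball f) (C : R) (hC : differential_bound alpha f C)
    (z : X) (hz : unit_ball z) (t0 : R) :
  0 < t0 <= 1 ->
  norm (minus (f (plus z (scal (RtoC t0) (opp z)))) (f z)) <= C / alpha * Rpower t0 alpha.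
Proof.
  intros ht0. pose proof (differential_bound_nonneg _ _ _ hC) as hC0.
  assert (hca : 0 <= C / alpha) by (apply Rdiv_le_0_compat; lra).
  set (g := fun w : Complex.C => f (plus z (scal w (opp z)))).
  assert (hg0 : g (RtoC 0) = f z).
  { unfold g. f_equal. change (RtoC 0) with (zero : C_AbsRing).
    now rewrite scal_zero_l plus_zero_r. }
  assert (hinc : forall s, 0 < s < t0 ->
    norm (minus (g (RtoC t0)) (g (RtoC s))) <= C / alpha * Rpower t0 alpha).
  { intros s hs.
    pose proof (norm_segment_increment_le f hf z (opp z)
      (fun t => C / alpha * Rpower t alpha) s t0 ltac:(lra)) as h.
    eapply Rle_trans; [apply h|].
    - intros t ht. pose proof (norm_line_to_origin z t ltac:(lra) hz) as hn.
      split; [unfold unit_ball; lra|].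
      exists (C / alpha * (alpha * Rpower t (alpha - 1))). split.
      + apply derivable_pt_lim_scal, derivable_pt_lim_power. lra.
      + pose proof (differential_bound_depth alpha ltac:(lra) f C hC _ t ltac:(lra) hn) as hb.
        replace (C / alpha * (alpha * Rpower t (alpha - 1)))
          with (C * Rpower t (alpha - 1)) by (field; lra).
        rewrite norm_opp. unfold unit_ball in hz.
        match type of hb with opnorm ?l <= _ => pose proof (opnorm_nonneg l) end.
        pose proof (norm_ge_0 z). nra.
    - pose proof (Rpower_pos s alpha). nra. }
  apply le_epsilon. intros e he.
  pose proof (frechet_spec f _ (hf z hz)) as hd.
  assert (hd0 : is_derive (K := C_AbsRing) g (RtoC 0) (frechet f z (opp z))).
  { apply is_derive_along_line. change (RtoC 0) with (zero : C_AbsRing).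
    now rewrite scal_zero_l plus_zero_r. }
  destruct (is_derive_real_increment g 0 _ hd0 1 ltac:(lra)) as [d [hdpos hcont]].
  set (N := norm (frechet f z (opp z)) + 1) in *.
  assert (hN : 0 < N) by (unfold N; pose proof (norm_ge_0 (frechet f z (opp z))); lra).
  set (s := Rmin (Rmin (d / 2) (t0 / 2)) (e / N)).
  assert (heN : 0 < e / N) by now apply Rdiv_lt_0_compat.
  assert (hs : 0 < s) by (repeat apply Rmin_glb_lt; lra).
  pose proof (Rmin_l (Rmin (d / 2) (t0 / 2)) (e / N)) as hs1. fold s in hs1.
  pose proof (Rmin_r (Rmin (d / 2) (t0 / 2)) (e / N)) as hs2. fold s in hs2.
  pose proof (Rmin_l (d / 2) (t0 / 2)). pose proof (Rmin_r (d / 2) (t0 / 2)).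
  specialize (hcont s). rewrite Rminus_0_r Rabs_pos_eq in hcont; [|lra].
  specialize (hcont ltac:(lra)). specialize (hinc s ltac:(lra)).
  assert (N * s <= e).
  { replace e with (N * (e / N)) by (field; lra). apply Rmult_le_compat_l; lra. }
  pose proof (norm_minus_trans (V := Y) (g (RtoC t0)) (g (RtoC s)) (g (RtoC 0))) as htri.
  rewrite hg0 in htri; rewrite hg0 in hcont. change (f (plus z (scal (RtoC t0) (opp z)))) with (g (RtoC t0)).
  lra.
Qed.

(** The segment from [z] to [w] may run close to the sphere, so the path first
    contracts both points by [1 - t0], [t0 = min (norm (z - w)) 1]. The contracted
    segment has depth at least [t0] and length at most [t0], and costs
    [C * t0 ^ alpha]; the two radial pieces cost [C / alpha * t0 ^ alpha] each. *)
Lemma holder_of_differential_bound alpha (halpha : 0 < alpha < 1) (f : X -> Y)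
    (hf : analytic_on_ball f) (C : R) (hC : differential_bound alpha f C) :
  holder_bound alpha f (4 / alpha * C).
Proof.
  intros z w hz hw. pose proof (differential_bound_nonneg _ _ _ hC) as hC0.
  assert (hca : 0 <= C / alpha) by (apply Rdiv_le_0_compat; lra).
  destruct (Req_dec (norm (minus z w)) 0) as [h0|h0].
  { assert (z = w) as <-.
    { apply norm_eq_zero in h0. rewrite -(plus_zero_r w) -h0 plus_comm. unfold minus.
      now rewrite -plus_assoc plus_opp_l plus_zero_r. }
    rewrite minus_eq_zero norm_zero. apply Rmult_le_pos; [|apply rpow_nonneg].
    replace (4 / alpha * C) with (4 * (C / alpha)) by (field; lra). lra. }
  set (d := norm (minus z w)) in *.
  assert (hd : 0 < d) by (pose proof (norm_ge_0 (minus z w)); unfold d in *; lra).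
  rewrite rpow_pos_eq //.
  set (t0 := Rmin d 1).
  assert (ht0 : 0 < t0 <= 1) by (split; [apply Rmin_glb_lt; lra | apply Rmin_r]).
  assert (htd : t0 <= d) by apply Rmin_l.
  (* When [d >= 1], both ends of the contracted segment are the origin. *)
  assert (hcase : (1 - t0) * d <= t0).
  { unfold t0, Rmin. destruct (Rle_dec d 1); nra. }
  set (z' := plus z (scal (RtoC t0) (opp z))).
  set (w' := plus w (scal (RtoC t0) (opp w))).
  pose proof (radial_increment alpha halpha f hf C hC z hz t0 ht0) as h1.
  pose proof (radial_increment alpha halpha f hf C hC w hw t0 ht0) as h2.
  fold z' in h1. fold w' in h2.
  pose proof (norm_line_to_origin z t0 (proj2 ht0) hz) as hz'. fold z' in hz'.
  pose proof (norm_line_to_origin w t0 (proj2 ht0) hw) as hw'. fold w' in hw'.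
  assert (hq : norm (minus w' z') = (1 - t0) * d).
  { replace (minus w' z') with (scal (RtoC (1 - t0)) (minus w z)).
    - rewrite norm_scal_C Cmod_R Rabs_pos_eq; [|lra]. now rewrite norm_minus_sym.
    - unfold z', w'. rewrite plus_minus_interchange -scal_minus_distr_l RtoC_minus.
      rewrite (scal_minus_distr_r (one : C_AbsRing) (RtoC t0 : C_AbsRing)) scal_one.
      unfold minus at 1. rewrite -scal_opp_r. f_equal. f_equal.
      unfold minus. now rewrite opp_plus. }
  assert (h3 : norm (minus (f w') (f z')) <= C * Rpower t0 alpha).
  { pose proof (norm_segment_increment_le f hf z' (minus w' z')
      (fun t => C * Rpower t0 alpha * t) 0 1 ltac:(lra)) as h.
    assert (he0 : plus z' (scal (RtoC 0) (minus w' z')) = z').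
    { change (RtoC 0) with (zero : C_AbsRing). now rewrite scal_zero_l plus_zero_r. }
    assert (he1 : plus z' (scal (RtoC 1) (minus w' z')) = w').
    { change (RtoC 1) with (one : C_AbsRing). rewrite scal_one plus_comm. unfold minus.
      now rewrite -plus_assoc plus_opp_l plus_zero_r. }
    rewrite he0 he1 in h. eapply Rle_trans; [apply h|lra].
    intros t ht.
    assert (hn : norm (plus z' (scal (RtoC t) (minus w' z'))) <= 1 - t0).
    { replace (plus z' (scal (RtoC t) (minus w' z')))
        with (plus (scal (RtoC (1 - t)) z') (scal (RtoC t) w')).
      - eapply Rle_trans; [apply (norm_triangle (V := X))|].
        rewrite !norm_scal_C !Cmod_R !Rabs_pos_eq; try lra. nra.
      - rewrite RtoC_minus (scal_minus_distr_r (one : C_AbsRing) (RtoC t : C_AbsRing)) scal_one.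
        rewrite scal_minus_distr_l. unfold minus. rewrite -plus_assoc. f_equal.
        now rewrite plus_comm. }
    split; [unfold unit_ball; lra|].
    exists (C * Rpower t0 alpha). split.
    - pose proof (derivable_pt_lim_scal id (C * Rpower t0 alpha) t 1 (derivable_pt_lim_id t)) as hlin.
      rewrite Rmult_1_r in hlin. exact hlin.
    - pose proof (differential_bound_depth alpha ltac:(lra) f C hC _ t0 ltac:(lra) hn) as hb.
      rewrite hq. rewrite Rpower_minus_1 in hb; [|lra].
      replace (C * Rpower t0 alpha) with (C * (Rpower t0 alpha / t0) * t0) by (field; lra).
      apply Rmult_le_compat; try lra; [apply opnorm_nonneg|]. nra. }
  assert (hpow : C / alpha * Rpower t0 alpha <= C / alpha * Rpower d alpha).
  { apply Rmult_le_compat_l; [exact hca|]. apply Rle_Rpower_l; lra. }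
  assert (hpow2 : C * Rpower t0 alpha <= C / alpha * Rpower t0 alpha).
  { apply Rmult_le_compat_r; [apply Rlt_le, Rpower_pos|].
    assert (C / alpha * alpha = C) by (field; lra). nra. }
  pose proof (norm_minus_trans (V := Y) (f z) (f z') (f w)) as h4.
  pose proof (norm_minus_trans (V := Y) (f z') (f w') (f w)) as h5.
  rewrite norm_minus_sym in h1. rewrite norm_minus_sym in h3.
  replace (4 / alpha * C * Rpower d alpha) with (4 * (C / alpha * Rpower d alpha)) by (field; lra).
  assert (0 <= C / alpha * Rpower d alpha)
    by (apply Rmult_le_pos; [exact hca | apply Rlt_le, Rpower_pos]).
  lra.
Qed.

(** Cauchy's estimate on the disc [z + x zeta], [Cmod x <= rho], gives
    [C * rho ^ (alpha - 1)] for each [rho < 1 - norm z]. The radius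
    [(1 - norm z) / 2] suffices: it loses the factor
    [2 ^ (1 - alpha) <= 2 <= 2 / alpha]. *)
Lemma differential_bound_of_holder alpha (halpha : 0 < alpha < 1) (f : X -> Y)
    (hf : analytic_on_ball f) (C : R) (hC0 : 0 <= C) (hC : holder_bound alpha f C) :
  differential_bound alpha f (2 / alpha * C).
Proof.
  intros z hz. set (r := 1 - norm z).
  assert (hr : 0 < r) by (unfold r, unit_ball in *; lra).
  rewrite rpow_pos_eq //.
  assert (h2a : 2 <= 2 / alpha).
  { assert (2 / alpha * alpha = 2) by (field; lra).
    assert (0 < 2 / alpha) by (apply Rdiv_lt_0_compat; lra). nra. }
  pose proof (Rpower_pos r (alpha - 1)) as hrp.
  assert (hCr : 0 <= C * Rpower r (alpha - 1)) by (apply Rmult_le_pos; lra).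
  apply opnorm_le; [nra|]. intros zeta hzeta.
  assert (hball : forall x : Complex.C, Cmod x <= r / 2 -> unit_ball (plus z (scal x zeta))).
  { intros x hx. unfold unit_ball. eapply Rle_lt_trans; [apply (norm_triangle (V := X))|].
    rewrite norm_scal_C hzeta. unfold r in *. lra. }
  assert (h0 : plus z (scal (RtoC 0) zeta) = z).
  { change (RtoC 0) with (zero : C_AbsRing). now rewrite scal_zero_l plus_zero_r. }
  assert (hcauchy : norm (frechet f z zeta) <= C * Rpower (r / 2) alpha / (r / 2)).
  { apply (cauchy_estimate (fun x => f (plus z (scal x zeta)))).
    - lra.
    - intros x hx. exists (frechet f (plus z (scal x zeta)) zeta).
      apply is_derive_along_line, frechet_spec, hf, hball, hx.
    - apply is_derive_along_line. rewrite h0. now apply frechet_spec, hf.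
    - intros x hx. rewrite h0.
      eapply Rle_trans; [apply hC; [apply hball; lra | exact hz]|].
      replace (minus (plus z (scal x zeta)) z) with (scal x zeta).
      + rewrite norm_scal_C hzeta Rmult_1_r hx rpow_pos_eq; lra.
      + rewrite plus_comm. unfold minus. now rewrite -plus_assoc plus_opp_r plus_zero_r. }
  assert (hhalf : Rpower (r / 2) (alpha - 1) <= 2 * Rpower r (alpha - 1)).
  { unfold Rdiv. rewrite -Rpower_mult_distr; [|lra|lra]. rewrite Rmult_comm.
    apply Rmult_le_compat_r; [lra|].
    replace 2 with (Rpower (/ 2) (- 1)) at 2; [|rewrite Rpower_Ropp Rpower_1; lra].
    unfold Rpower. apply exp_nondecreasing.
    assert (ln (/ 2) < 0) by (rewrite -ln_1; apply ln_increasing; lra). nra. }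
  unfold Rdiv in hcauchy. rewrite Rmult_assoc in hcauchy.
  change (Rpower (r * / 2) alpha * / (r * / 2)) with (Rpower (r / 2) alpha / (r / 2)) in hcauchy.
  rewrite -Rpower_minus_1 in hcauchy; [|lra]. nra.
Qed.
End HardyLittlewood.

(* [0 <= C'] is automatic unless [X] is the zero space, where the Hölder
   condition would hold vacuously for negative constants too. *)
Theorem corollary3p5 (alpha : R) (halpha : 0 < alpha < 1)
    (X Y : NormedModule C_AbsRing) (f : X -> Y) (hf : analytic_on_ball f) :
  ((exists C : R, differential_bound alpha f C) <->
   (exists C' : R, holder_bound alpha f C')) /\
  (forall C : R, differential_bound alpha f C ->
     exists C' : R, C' <= 4 / alpha * C /\ holder_bound alpha f C') /\
  (forall C' : R, 0 <= C' -> holder_bound alpha f C' ->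
     exists C : R, C <= 2 / alpha * C' /\ differential_bound alpha f C).
Proof.
  split; [split|split].
  - intros [C hC]. eexists. exact (holder_of_differential_bound alpha halpha f hf C hC).
  - intros [C hC]. exists (2 / alpha * Rmax 0 C).
    apply differential_bound_of_holder; [exact halpha|exact hf|apply Rmax_l|].
    intros z w hz hw. eapply Rle_trans; [now apply hC|].
    apply Rmult_le_compat_r; [apply rpow_nonneg | apply Rmax_r].
  - intros C hC. eexists. split; [apply Rle_refl|].
    now apply holder_of_differential_bound.
  - intros C hC0 hC. eexists. split; [apply Rle_refl|].
    now apply differential_bound_of_holder.
Qed.
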